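(* Let $Q$ be a quadratical quasigroup, let $a,b\in Q$ with $a\neq b$, and let $C$ and $D$ be two $4$-cycles based on $aba$. Then, as sets, either $C=D$ or $C\cap D=\varnothing$.
   Context: A groupoid is a nonempty set with a binary operation, written as juxtaposition. A groupoid $G$ is right solvable if for all $a,b\in G$ there is a unique $x\in G$ with $ax=b$. It has property A if $(xy)x=(zx)(yz)$ for all $x,y,z\in G$. A quadratical quasigroup is a right solvable groupoid with property A (such a groupoid is known to be a quasigroup). In a quadratical quasigroup $x(yx)=(xy)x$ for all $x,y$, and this element is written $xyx$. For $a\neq b$ in $Q$, a $4$-cycle based on $aba$ is a set $\{x_1,x_2,x_3,x_4\}$ (listed in order) of $4$ distinct elements of $Q$ such that $aba=x_1x_2=x_2x_3=x_3x_4=x_4x_1$. *)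

(* Defs.v *)
From mathcomp Require Import all_boot.
From mathcomp Require Import classical_sets.

Set Implicit Arguments.
Unset Strict Implicit.
Unset Printing Implicit Defensive.

Section Groupoid.
Context {Q : Type} (mul : Q -> Q -> Q).
Local Notation "x * y" := (mul x y).

Definition right_solvable : Prop := forall a b : Q, exists! x : Q, a * x = b.

Definition property_A : Prop :=
  forall x y z : Q, (x * y) * x = (z * x) * (y * z).

Record quadratical_quasigroup : Prop := QuadraticalQuasigroup {
  qq_nonempty : inhabited Q;
  qq_right_solvable : right_solvable;
  qq_property_A : property_A
}.

(* The element xyx; the choice of bracketing is immaterial by [sandwichE]. *)
Definition sandwich (x y : Q) : Q := (x * y) * x.

Lemma sandwichE (hQ : quadratical_quasigroup) (x y : Q) :
  sandwich x y = x * (y * x).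
Proof.
have xx : x * x = x.
  have [z [_ zP]] := qq_right_solvable hQ (x * x) ((x * x) * x).
  by rewrite -(zP _ (esym (qq_property_A hQ x x x))) (zP x erefl).
by rewrite /sandwich (qq_property_A hQ x y x) xx.
Qed.

Definition four_cycle_based_on (a b : Q) (C : set Q) : Prop :=
  exists x1 x2 x3 x4 : Q,
    [/\ C = [set x1; x2; x3; x4]%classic,
        [/\ x1 <> x2, x1 <> x3 & x1 <> x4],
        [/\ x2 <> x3, x2 <> x4 & x3 <> x4] &
        [/\ sandwich a b = x1 * x2, sandwich a b = x2 * x3,
            sandwich a b = x3 * x4 & sandwich a b = x4 * x1]].

End Groupoid.

(* Main.v *)
Require Import Defs.
From mathcomp Require Import all_boot.
From mathcomp Require Import boolp classical_sets.

Local Open Scope classical_set_scope.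

(** Put c = aba.  In a right solvable groupoid each x has exactly one
successor, the solution y of xy = c.  A 4-cycle based on c lists each of its
elements followed by its successor, cyclically, so it can be recovered from
any one of its elements x as x, its successor, and so on
([four_cycle_from]).  Two 4-cycles based on c that share an element are
therefore the same set. *)

Lemma right_solvable_cancel (Q : Type) (mul : Q -> Q -> Q)
    (hQ : right_solvable mul) (x y z : Q) :
  mul x y = mul x z -> y = z.
Proof.
move=> xyz; have [w [_ wP]] := hQ x (mul x z).
by rewrite -(wP y xyz) (wP z erefl).
Qed.

Lemma set4_rot (T : Type) (x y z t : T) :
  [set x; y; z; t] = [set y; z; t; x].
Proof. by rewrite [RHS]setUC !setUA. Qed.

(** The defining equations of a 4-cycle are invariant under rotation of the
list, so the listing may start at any element. *)
Lemma four_cycle_from (Q : Type) (mul : Q -> Q -> Q) (a b : Q) (C : set Q)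
    (x : Q) :
  four_cycle_based_on mul a b C -> C x ->
  exists y z t, [/\ C = [set x; y; z; t], sandwich mul a b = mul x y,
    sandwich mul a b = mul y z & sandwich mul a b = mul z t].
Proof.
move=> [x1 [x2 [x3 [x4 [-> _ _ [e1 e2 e3 e4]]]]]] [[[->|->]|->]|->].
- by exists x2, x3, x4.
- by exists x3, x4, x1; split=> //; rewrite set4_rot.
- by exists x4, x1, x2; split=> //; rewrite 2!set4_rot.
- by exists x1, x2, x3; split=> //; rewrite 3!set4_rot.
Qed.

Theorem proposition3p3 (Q : Type) (mul : Q -> Q -> Q)
    (hQ : quadratical_quasigroup mul) (a b : Q) (hab : a <> b)
    (C D : set Q) (hC : four_cycle_based_on mul a b C)
    (hD : four_cycle_based_on mul a b D) :
  C = D \/ C `&` D = set0.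
Proof.
have cancel := right_solvable_cancel _ _ (qq_right_solvable hQ).
have [CD0|/eqP/set0P[x [Cx Dx]]] := EM (C `&` D = set0); [by right|left].
have [y [z [t [-> exy eyz ezt]]]] := four_cycle_from _ _ _ _ _ _ hC Cx.
have [y' [z' [t' [-> exy' eyz' ezt']]]] := four_cycle_from _ _ _ _ _ _ hD Dx.
have yy' : y = y' by apply: (cancel x); rewrite -exy.
have zz' : z = z' by apply: (cancel y); rewrite -eyz yy'.
have tt' : t = t' by apply: (cancel z); rewrite -ezt zz'.
by rewrite yy' zz' tt'.
Qed.
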